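(* Let $n\ge5$ and let $M$ be a kernel-free MLS on $[n]$ with $M\ne\mathcal F_a^{*}$ for every $a\in[n]$. Then $$\Lambda(M)\;\le\;M_n^{*}-\bigl(2^{\,n-2}-4\bigr)\;=\;3^{\,n-1}-3\cdot2^{\,n-2}+6,$$ and this bound is attained. Among such $M$, equality holds precisely for (a) the $n(n-1)$ systems $U_{a,B}$ with $a\in[n]$, $B\subseteq[n]\setminus\{a\}$, $|B|=n-2$, for every $n\ge5$; and (b) when $n=5$ only, in addition the $10$ balls $\mathcal A_T=\{S\subseteq[5]:|S\cap T|\ge2\}$, $T\in\binom{[5]}{3}$. In particular there is no kernel-free MLS on $[n]$ whose $\Lambda$-value lies strictly between $3^{\,n-1}-3\cdot2^{\,n-2}+6$ and the maximum $M_n^{*}=3^{\,n-1}-2^{\,n-1}+2$ of $\Lambda$ over kernel-free MLS on $[n]$; these two values differ by $2^{\,n-2}-4$.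
   Context: $[n]=\{1,\dots,n\}$; $V_n$ is the set of nonempty subsets of $[n]$; $\binom{X}{k}$ is the set of $k$-element subsets of $X$. A family $\mathcal F\subseteq V_n$ is intersecting if $A\cap B\ne\varnothing$ for all $A,B\in\mathcal F$. A maximal linked system (MLS) on $[n]$ is an intersecting family $\mathcal F\subseteq V_n$ that is maximal under inclusion. A family is kernel-free if $\bigcap_{S\in\mathcal F}S=\varnothing$. $\Lambda(\mathcal F)=\sum_{S\in\mathcal F}2^{n-|S|}$, and $M_n^{*}=3^{n-1}-2^{n-1}+2$. $\mathrm{Star}(a)=\{S\in V_n:a\in S\}$, and $\mathcal F_a^{*}=(\mathrm{Star}(a)\setminus\{\{a\}\})\cup\{[n]\setminus\{a\}\}$ is the one-flip star at $a$. For $i\in[n]$ and $B\subseteq[n]\setminus\{i\}$ with $|B|\ge2$, $U_{i,B}=\{S\subseteq[n]: i\in S,\ S\cap B\ne\varnothing\}\cup\{S\subseteq[n]:i\notin S,\ B\subseteq S\}$. *)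

(* Defs.v *)
From mathcomp Require Import all_boot.

Set Implicit Arguments.
Unset Strict Implicit.
Unset Printing Implicit Defensive.

(* The ground set [n] is 'I_n, a family of subsets of [n] is a               *)
(* {set {set 'I_n}}. The weights and bounds live in nat, where subtraction   *)
(* truncates; no truncation occurs in the expressions below when 5 <= n.     *)

Definition ne_subsets n : {set {set 'I_n}} := [set S | S != set0].

Definition intersecting n (F : {set {set 'I_n}}) : bool :=
  [forall A in F, forall B in F, A :&: B != set0].

Definition mls n (F : {set {set 'I_n}}) : bool :=
  maxset (fun G => (G \subset ne_subsets n) && intersecting G) F.

(* An empty intersection is [set: 'I_n]. *)
Definition kernel_free n (F : {set {set 'I_n}}) : bool :=
  \bigcap_(S in F) S == set0.

Definition Lambda n (F : {set {set 'I_n}}) : nat :=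
  \sum_(S in F) 2 ^ (n - #|S|).

Definition Mstar n : nat := 3 ^ n.-1 - 2 ^ n.-1 + 2.

Definition star n (a : 'I_n) : {set {set 'I_n}} :=
  [set S in ne_subsets n | a \in S].

Definition one_flip_star n (a : 'I_n) : {set {set 'I_n}} :=
  (star a :\ [set a]) :|: [set [set~ a]].

(* Meaningful when B \subset [set~ i] and 2 <= #|B|. *)
Definition U n (i : 'I_n) (B : {set 'I_n}) : {set {set 'I_n}} :=
  [set S : {set 'I_n} | (i \in S) && (S :&: B != set0)]
    :|: [set S : {set 'I_n} | (i \notin S) && (B \subset S)].

Definition ball n (T : {set 'I_n}) : {set {set 'I_n}} :=
  [set S : {set 'I_n} | 2 <= #|S :&: T|].

Definition U_systems n : {set {set {set 'I_n}}} :=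
  [set U a B | a : 'I_n,
               B : {set 'I_n} in [set B : {set 'I_n} |
                                   (B \subset [set~ a]) && (#|B| == n.-2)]].

Definition ball_systems n : {set {set {set 'I_n}}} :=
  [set ball T | T : {set 'I_n} in [set T : {set 'I_n} | #|T| == 3]].

Definition nonextremal_mls n (M : {set {set 'I_n}}) : Prop :=
  [/\ mls M, kernel_free M & forall a : 'I_n, M <> one_flip_star a].

(* Main.v *)
Require Import Defs.
From mathcomp Require Import all_boot.
From mathcomp Require Import fingroup perm zify.

(* An MLS contains exactly one of each complementary pair S, ~: S. Writing m_k
   for its number of k-element members, m_k + m_(n-k) = 'C(n, k), so Lambda is,
   up to a constant depending on n only, the sum over k < n/2 of
   m_k (2^(n-k) - 2^k). By Erdos-Ko-Rado (proved by Katona's circle argument)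
   m_k <= 'C(n-1, k-1), the value for a star, and m_1 = 0 for a kernel-free
   system. The two-element members pairwise meet, hence form a star of pairs or
   lie in a triangle: m_2 = n-1 forces the one-flip star, and m_2 = n-2 forces
   some U a B, or a ball when n = 5. So the remaining systems have m_2 <= n-2,
   which costs 2^(n-2) - 4 with respect to the one-flip star. *)

Set Implicit Arguments.
Unset Strict Implicit.
Unset Printing Implicit Defensive.

(** * The Erdos-Ko-Rado theorem *)

(* [offset n i x] is [x - i] modulo [n], for [i, x < n]. *)
Definition offset n (i x : nat) := if i <= x then x - i else x + n - i.

Lemma offset_lt n (i x : 'I_n) : offset n i x < n.
Proof. have hx := ltn_ord x; rewrite /offset; case: ifP => ?; lia. Qed.

Lemma offset_inj n (i x y : 'I_n) : offset n i x = offset n i y -> x = y.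
Proof.
move=> e; apply/val_inj => /=; move: e; rewrite /offset.
by have [hx hy hi] := And3 (ltn_ord x) (ltn_ord y) (ltn_ord i); do 2!case: ifP => ?; lia.
Qed.

(** Rotation invariance: positions may be read from any origin [j], so one chosen arc can be taken
    to start at 0. *)
Lemma offset_offset n (j i x : 'I_n) :
  offset n i x = offset n (offset n j i) (offset n j x).
Proof.
have [hx hi hj] := And3 (ltn_ord x) (ltn_ord i) (ltn_ord j).
by rewrite /offset; case: (leqP j i) => ?; case: (leqP j x) => ?; do 2!case: ifP => ?; lia.
Qed.

Definition arc n k (i : 'I_n) : {set 'I_n} := [set x : 'I_n | offset n i x < k].

Lemma card_arc n k (i : 'I_n) : k <= n -> #|arc k i| = k.
Proof.
move=> lekn; pose f x := Ordinal (offset_lt i x).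
have injf : injective f by move=> x y /(congr1 val) /offset_inj.
have -> : arc k i = f @^-1: (widen_ord lekn @: setT).
  apply/setP=> x; rewrite !inE; apply/idP/imsetP => [ltk | [t _ /(congr1 val)/= ->]].
    by exists (Ordinal ltk) => //; apply: val_inj.
  exact: ltn_ord.
rewrite card_preimset // card_imset ?cardsT ?card_ord //.
by move=> s t /(congr1 val) /= /val_inj.
Qed.

(** The start [d + n - k] is [d - k] modulo [n]: its arc ends just before [d], and [k.*2 <= n]
    prevents an overlap on the other side. *)
Lemma offset_clash n k d x : k.*2 <= n -> x < n -> d < k ->
  offset n d x < k -> offset n (d + n - k) x < k -> False.
Proof. by move=> ? ? ?; rewrite /offset; case: ifP => ?; case: ifP => ?; lia. Qed.

Lemma near_offset n k d x : k.*2 <= n -> x < n -> d < n ->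
  x < k -> offset n d x < k -> k <= d -> n < d + k.
Proof. by move=> ? ? ?; rewrite /offset; case: ifP => ?; lia. Qed.

(* Identifies the offsets [d] and [d + k - n], whose arcs are disjoint; this is
   the pairing of Katona's argument. *)
Definition fold_offset n k d := if d < k then d else d + k - n.

(** The points [y] and [z] witness that both arcs meet the arc from 0. Equal folded values then
    leave [i = j] or starts differing by [k] modulo [n]; the common point [x] excludes the latter by
    [offset_clash]. *)
Lemma fold_offset_inj n k i j x y z : k.*2 <= n ->
  i < n -> j < n -> x < n -> y < n -> z < n ->
  fold_offset n k i = fold_offset n k j ->
  y < k -> offset n i y < k -> z < k -> offset n j z < k ->
  offset n i x < k -> offset n j x < k -> i = j.
Proof.
move=> le2kn lt_i lt_j lt_x lt_y lt_z; rewrite /fold_offset => e y0 yi z0 zj.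
have := @near_offset n k i y le2kn lt_y lt_i y0 yi.
have := @near_offset n k j z le2kn lt_z lt_j z0 zj.
move: e {y0 yi z0 zj}; case: (ltnP i k) => ik; case: (ltnP j k) => jk e nj ni xi xj //.
- case: (@offset_clash n k i x) => //.
  by have -> : i + n - k = j by have := nj isT; lia.
- case: (@offset_clash n k j x) => //.
  by have -> : j + n - k = i by have := ni isT; lia.
- by have := nj isT; have := ni isT; lia.
Qed.

(** Katona's bound: measured from the start [j0] of one fixed arc, the starts fold injectively into
    [k] values. *)
Lemma card_meeting_arcs n k (J : {set 'I_n}) : k.*2 <= n ->
  {in J &, forall i j, arc k i :&: arc k j != set0} -> #|J| <= k.
Proof.
move=> le2kn meetJ; have [->|[j0 j0J]] := set_0Vmem J; first by rewrite cards0.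
have meet i j : i \in J -> j \in J -> exists x : 'I_n, offset n i x < k /\ offset n j x < k.
  move=> iJ jJ; have /set0Pn[x] := meetJ i j iJ jJ.
  by rewrite !inE => /andP[]; exists x.
have k_gt0 : 0 < k by have [x []] := meet _ _ j0J j0J; case: (k).
pose g (j : 'I_n) := fold_offset n k (offset n j0 j).
have g_lt j : j \in J -> g j < k.
  move=> jJ; rewrite /g /fold_offset; case: ifP => // _; have := offset_lt j0 j; lia.
have g_inj : {in J &, injective g}.
  move=> i j iJ jJ e; apply: (@offset_inj _ j0).
  have [x [xi xj]] := meet i j iJ jJ.
  have [y [y0 yi]] := meet j0 i j0J iJ.
  have [z [z0 zj]] := meet j0 j j0J jJ.
  move: xi xj yi zj; rewrite (offset_offset j0 i x) (offset_offset j0 j x).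
  rewrite (offset_offset j0 i y) (offset_offset j0 j z) => xi xj yi zj.
  apply: (fold_offset_inj le2kn _ _ _ _ _ e y0 yi z0 zj xi xj); exact: offset_lt.
have <- : #|'I_k| = k by rewrite card_ord.
(* The default of [insubd] is never taken on [J], by [g_lt]. *)
pose h j : 'I_k := insubd (Ordinal k_gt0) (g j).
rewrite -(card_in_imset (f := h)) ?max_card // => i j iJ jJ /(congr1 val).
by rewrite /= !insubdK -?topredE /= ?g_lt //; apply: g_inj.
Qed.

(** Induction on [#|A :\: B|]: transposing a point of [A :\: B] with one of [B :\: A] shrinks the
    difference. *)
Lemma perm_imset_exists (T : finType) (A B : {set T}) :
  #|A| = #|B| -> exists s : {perm T}, s @: A = B.
Proof.
move: {2}#|A :\: B| (leqnn #|A :\: B|) => m; elim: m A => [|m IH] A.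
  rewrite leqn0 cards_eq0 setD_eq0 => sAB eqAB; exists 1%g.
  have /eqP -> : A == B by rewrite eqEcard sAB eqAB leqnn.
  by rewrite -[RHS]imset_id; apply: eq_imset => x; rewrite perm1.
move=> leAB eqAB; have [AB0|[x]] := set_0Vmem (A :\: B).
  by apply: IH => //; rewrite AB0 cards0.
rewrite inE => /andP[xB xA].
have [y] : exists y, y \in B :\: A.
  apply/set0Pn; rewrite -cards_eq0.
  have := cardsID A B; have := cardsID B A; rewrite setIC eqAB.
  have : 0 < #|A :\: B| by apply/card_gt0P; exists x; rewrite inE xA xB.
  lia.
rewrite inE => /andP[yA yB].
set t := tperm x y.
have [s sB] : exists s : {perm T}, s @: (t @: A) = B.
  apply: IH; last by rewrite card_imset //; apply: perm_inj.
  have /subset_leq_card : (t @: A) :\: B \subset (A :\: B) :\ x.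
    apply/subsetP=> z; rewrite !inE => /andP[zB /imsetP[u uA eq_z]].
    move: zB; rewrite {}eq_z /t; case: tpermP => [_|uy|ux uy] zB.
    - by rewrite yB in zB.
    - by rewrite uy (negPf yA) in uA.
    - by rewrite zB uA !andbT; apply/eqP.
  have := cardsD1 x (A :\: B); rewrite !inE xA xB /=; lia.
exists (t * s)%g; rewrite -[RHS]sB -imset_comp.
by apply: eq_imset => z; rewrite permM.
Qed.

(** Double count of the pairs [(s, B)] with [#|B| = #|A|] and [s @: B \in F]: every [B] has the same
    number of [s], and every [s] has [#|F|] sets [B]. *)
Lemma card_perm_imset_mem (T : finType) (A : {set T}) (F : {set {set T}}) :
  {in F, forall S : {set T}, #|S| = #|A|} ->
  #|[set s : {perm T} | s @: A \in F]| * 'C(#|T|, #|A|) = #|{perm T}| * #|F|.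
Proof.
move=> cardF.
pose N (B : {set T}) : nat := #|[set s : {perm T} | s @: B \in F]|.
(* Left multiplication by a [t] with [t @: B = A] matches the two sets of permutations. *)
have N_const (B : {set T}) : #|B| = #|A| -> N B = N A.
  move=> /perm_imset_exists[t <-]; rewrite /N -[RHS](card_imset _ (mulgI t)).
  have act_mul (s : {perm T}) : s @: (t @: B) = (t * s)%g @: B.
    by rewrite -imset_comp; apply: eq_imset => x; rewrite permM.
  apply: eq_card => u; rewrite [LHS]inE; apply/idP/imsetP => [uF|[s]].
    by exists (t^-1 * u)%g; rewrite ?inE ?act_mul mulKVg.
  by rewrite inE act_mul => sF ->.
transitivity (\sum_(B : {set T} | #|B| == #|A|) N B).
  rewrite (eq_bigr (fun=> N A)) => [|B /eqP]; last exact: N_const.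
  rewrite sum_nat_const mulnC -/(N A); congr (_ * _).
  by rewrite -card_draws; apply: eq_card => B; rewrite !inE.
under eq_bigr => B _ do rewrite /N -sum1_card.
under eq_bigr => B _ do under eq_bigl => s do rewrite inE.
rewrite (exchange_big_dep predT) //= -sum_nat_const.
apply: eq_bigr => s _; rewrite sum1_card.
have inj_s := imset_inj (@perm_inj _ s).
rewrite -cardsE -(card_imset _ inj_s); apply: eq_card => S; apply/imsetP/idP => [[B]|SF].
  by rewrite inE => /andP[_ BF] ->.
have sK : s @: ((s^-1)%g @: S) = S.
  rewrite -imset_comp -[RHS]imset_id; apply: eq_imset => x.
  by rewrite /= permKV.
exists ((s^-1)%g @: S); last by rewrite sK.
by rewrite inE unfold_in sK SF andbT card_imset ?cardF //; apply: perm_inj.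
Qed.

Lemma intersectingP n (F : {set {set 'I_n}}) :
  reflect {in F &, forall A B, A :&: B != set0} (intersecting F).
Proof.
apply: (iffP 'forall_in_forall_inP) => intF A B; first by move=> /intF; apply.
by move=> AF BF; apply: intF.
Qed.

(** Count the pairs [(i, s)] for which [s] carries the arc at [i] into [F]: each [s] allows at most
    [k] arcs, and each arc accounts for the same number of [s]. *)
Lemma erdos_ko_rado n k (F : {set {set 'I_n}}) : k.*2 <= n -> 0 < k ->
  intersecting F -> {in F, forall S : {set 'I_n}, #|S| = k} ->
  #|F| <= 'C(n.-1, k.-1).
Proof.
move=> le2kn k_gt0 /intersectingP intF cardF.
have lekn : k <= n by rewrite (leq_trans _ le2kn) // -addnn leq_addl.
have n_gt0 : 0 < n by apply: leq_trans lekn.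
have le_sum : \sum_(i : 'I_n) #|[set s : {perm 'I_n} | s @: arc k i \in F]|
    <= #|{perm 'I_n}| * k.
  under eq_bigr => i _ do rewrite -sum1_card.
  under eq_bigr => i _ do under eq_bigl => s do rewrite inE.
  rewrite (exchange_big_dep predT) //= -sum_nat_const leq_sum // => s _.
  rewrite sum1_card -[X in X <= _]/#|[pred i | s @: arc k i \in F]|.
  rewrite -cardsE; apply: card_meeting_arcs => // i j; rewrite !inE => iF jF.
  have /set0Pn[_ /setIP[/imsetP[x xi ->] xj]] := intF _ _ iF jF.
  by apply/set0Pn; exists x; rewrite inE xi -(mem_imset _ _ (@perm_inj _ s)).
have pS : 0 < #|{perm 'I_n}| by apply/card_gt0P; exists 1%g.
have : n * #|F| <= k * 'C(n, k).
  rewrite -(leq_pmul2l pS) mulnCA -[n in n * _]card_ord -sum_nat_const.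
  rewrite mulnA; apply: leq_trans (leq_mul le_sum (leqnn 'C(n, k))).
  rewrite big_distrl /= leq_sum // => i _.
  have := @card_perm_imset_mem _ (arc k i) F; rewrite card_arc // card_ord => -> //.
have -> : k * 'C(n, k) = n * 'C(n.-1, k.-1) by rewrite mul_bin_diag prednK.
by rewrite leq_pmul2l.
Qed.

(** * Maximal linked systems *)

Section MaximalLinkedSystems.

Variables (n : nat) (n_gt0 : 0 < n).
Implicit Types (M N F : {set {set 'I_n}}) (S A B : {set 'I_n}) (a x : 'I_n).

Lemma mls_meet M A B : mls M -> A \in M -> B \in M -> A :&: B != set0.
Proof. by case/maxsetP=> /andP[_ /intersectingP intM] _; apply: intM. Qed.

Lemma mls_mem M S : mls M -> S != set0 -> {in M, forall A, S :&: A != set0} -> S \in M.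
Proof.
move=> /maxsetP[/andP[/subsetP neM /intersectingP intM] maxM] neS meetS.
have <- : S |: M = M; last by rewrite setU11.
apply: maxM; last exact: subsetUr.
apply/andP; split.
  apply/subsetP=> A; case/setU1P => [->|]; [by rewrite inE | exact: neM].
apply/intersectingP => A B /setU1P[->|AM] /setU1P[->|BM].
- by rewrite setIid.
- exact: meetS.
- by rewrite setIC; apply: meetS.
- exact: intM.
Qed.

Lemma mls_up M A B : mls M -> A \in M -> A \subset B -> B \in M.
Proof.
move=> mlsM AM sAB; apply: mls_mem => // [|C CM].
  have := mls_meet mlsM AM AM; rewrite setIid -!card_gt0 => A_gt0.
  exact: leq_trans (subset_leq_card sAB).
have := mls_meet mlsM AM CM; rewrite -!card_gt0 => AC_gt0.
exact: leq_trans (subset_leq_card (setSI C sAB)).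
Qed.

(** If [S] is not a member, some member [A] misses it, since otherwise [S] could be added; then
    [A \subset ~: S]. *)
Lemma mls_compl M S : mls M -> (~: S \in M) = (S \notin M).
Proof.
move=> mlsM; apply/idP/idP => [CM | notSM].
  by apply/negP=> SM; have := mls_meet mlsM SM CM; rewrite setICr eqxx.
(* [mls_mem] requires a nonempty set, so the empty [S] is treated apart; [0 < n] makes its
   complement nonempty. *)
have [S0 | neS] := eqVneq S set0.
  rewrite S0 setC0; apply: mls_mem => // [|A AM].
    by apply/set0Pn; exists (Ordinal n_gt0); rewrite inE.
  by have := mls_meet mlsM AM AM; rewrite setTI setIid.
have : ~~ [forall A in M, S :&: A != set0].
  by apply: contra notSM => /forall_inP meetS; apply: mls_mem.
case/forall_inPn => A AM; rewrite negbK setI_eq0 disjoint_sym disjoints_subset.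
exact: mls_up.
Qed.

(** A proper intersecting extension would contain some set together with its complement. *)
Lemma mls_intro F : intersecting F -> (forall S, S \notin F -> ~: S \in F) -> mls F.
Proof.
move=> intF complF; have /intersectingP meetF := intF.
apply/maxsetP; split.
  rewrite intF andbT; apply/subsetP => A AF.
  by rewrite inE; have := meetF A A AF AF; rewrite setIid.
move=> G /andP[_ /intersectingP meetG] sFG; apply/eqP; rewrite eqEsubset sFG andbT.
apply/subsetP=> A AG; apply: contraT => /complF /(subsetP sFG) CAG.
by have := meetG _ _ AG CAG; rewrite setICr eqxx.
Qed.

Lemma mls_subset_eq M N : mls M -> mls N -> M \subset N -> N = M.
Proof. by move=> /maxsetP[_ maxM] /maxsetP[PN _]; apply: maxM. Qed.

(** A point lies in all members iff the complement of its singleton is not a member, that is, iff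
    the singleton is one. *)
Lemma mls_kernel_freeP M : mls M ->
  reflect (forall x, [set x] \notin M) (kernel_free M).
Proof.
move=> mlsM; rewrite /kernel_free.
have capE x : (x \in \bigcap_(S in M) S) = ([set x] \in M).
  apply/bigcapP/idP => [allx|xM S SM].
    rewrite -[_ \in M]negbK -mls_compl //; apply/negP => /allx.
    by rewrite !inE eqxx.
  by have /set0Pn[y] := mls_meet mlsM xM SM; rewrite !inE => /andP[/eqP ->].
apply: (iffP eqP) => [cap0 x|nox]; first by rewrite -capE cap0 inE.
by apply/setP=> x; rewrite capE inE; apply/negbTE.
Qed.

(** * Layers by cardinality and the weight *)

Definition layer F k : nat := #|[set S in F | #|S| == k]|.

Lemma Lambda_layers F : Lambda F = \sum_(k < n.+1) layer F k * 2 ^ (n - k).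
Proof.
have le_card S : #|S| < n.+1 by rewrite ltnS -[n in _ <= n]card_ord max_card.
rewrite /Lambda (partition_big (fun S => Ordinal (le_card S)) predT) //=.
apply: eq_bigr => k _; rewrite (eq_bigr (fun=> 2 ^ (n - k))).
  by rewrite sum_nat_const; congr (_ * _); apply: eq_card => S; rewrite !inE.
by move=> S /andP[_ /eqP <-].
Qed.

Lemma mls_layer_compl M k : mls M -> k <= n ->
  layer M k + layer M (n - k) = 'C(n, k).
Proof.
move=> mlsM lekn; rewrite -{2}[n]card_ord -card_draws.
rewrite -(cardsID M [set A : {set 'I_n} | #|A| == k]); congr (_ + _).
  by apply: eq_card => S; rewrite !inE andbC.
rewrite /layer -(card_imset _ (inv_inj (@setCK _))); apply: eq_card => S.
have cardC := cardsC S; rewrite card_ord in cardC.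
rewrite !inE; apply/imsetP/andP => [[A]|[SM /eqP cardS]].
  rewrite inE => /andP[AM /eqP cardA] defS.
  move: cardC; rewrite defS setCK -mls_compl // setCK AM cardA => ?; split=> //.
  by apply/eqP; lia.
exists (~: S); rewrite ?setCK // inE mls_compl // SM; apply/eqP; lia.
Qed.

(* For k >= n / 2 the truncated gain is 0, so only the lower layers count. *)
Definition layer_gain k := 2 ^ (n - k) - 2 ^ k.

(** Adding the sum over layers to its reversal pairs layer [k] with layer [n - k]. The doubling
    spares a separate treatment of the middle layer. *)
Lemma mls_Lambda_double M : mls M ->
  2 * Lambda M = \sum_(k < n.+1) 'C(n, k) * 2 ^ minn k (n - k)
                 + 2 * \sum_(k < n.+1) layer M k * layer_gain k.
Proof.
move=> mlsM; rewrite !mul2n -!addnn {1}Lambda_layers.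
rewrite Lambda_layers [X in _ + X = _](reindex_inj rev_ord_inj) /= -big_split /=.
rewrite [X in _ = _ + (_ + X)](reindex_inj rev_ord_inj) /= -!big_split /=.
apply: eq_bigr => k _; rewrite subSS.
have lekn : k <= n by rewrite -ltnS.
rewrite -(mls_layer_compl mlsM lekn) /layer_gain subKn //.
(* Subtraction truncates, so [v - u] is 0 here and the gain of only one of the two paired layers
   survives. *)
have balance p q u v : v <= u ->
    p * u + q * v = (p + q) * v + (p * (u - v) + q * (v - u)).
  by move=> levu; rewrite -{1}(subnK levu) (eqP levu) muln0 addn0 mulnDr mulnDl; lia.
have [le_k | /ltnW le_k] := leqP k (n - k).
  by rewrite balance // leq_pexp2l.
rewrite addnC balance ?leq_pexp2l //.
by congr (_ * _ + _); exact: addnC.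
Qed.

Lemma mls_Lambda_exchange M N : mls M -> mls N ->
  Lambda M + \sum_(k < n.+1) layer N k * layer_gain k
  = Lambda N + \sum_(k < n.+1) layer M k * layer_gain k.
Proof. by move=> /mls_Lambda_double eM /mls_Lambda_double eN; lia. Qed.

End MaximalLinkedSystems.

(** * Stars, the systems [U a B], balls, and intersecting families of pairs *)

Section ConcreteSystems.

Variable n : nat.
Implicit Types (M N F : {set {set 'I_n}}) (S A B T : {set 'I_n}) (a x : 'I_n).

Lemma in_star a S : (S \in star a) = (a \in S).
Proof.
rewrite !inE andb_idl // => aS.
by apply/set0Pn; exists a.
Qed.

Lemma star_mls a : mls (star a).
Proof.
apply: mls_intro => [|S]; last by rewrite !in_star inE.
apply/intersectingP => A B; rewrite !in_star => aA aB.
by apply/set0Pn; exists a; rewrite inE aA.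
Qed.

(** Pascal's rule: the sets of size [k.+1] avoiding [a] are those of [[set~ a]]. *)
Lemma layer_star a k : layer (star a) k.+1 = 'C(n.-1, k).
Proof.
have n_gt0 : 0 < n by apply: leq_ltn_trans (ltn_ord a).
have cardCa : #|[set~ a]| = n.-1 by rewrite cardsC1 card_ord.
have := cardsID (star a) [set S : {set 'I_n} | #|S| == k.+1].
rewrite card_draws card_ord -[X in 'C(X, _)](prednK n_gt0) binS.
have -> : [set S : {set 'I_n} | #|S| == k.+1] :\: star a
    = [set S : {set 'I_n} | S \subset [set~ a] & #|S| == k.+1].
  apply/setP=> S; rewrite in_setD in_star !inE; congr (_ && _).
  by rewrite subsetC sub1set inE.
rewrite cards_draws cardCa addnC => /addnI <-.
by rewrite /layer; apply: eq_card => S; rewrite in_setI andbC !in_set.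
Qed.

(** Binomial expansion of [(2 + 1) ^ n.-1]. The star is the reference system with which kernel-free
    ones are compared. *)
Lemma Lambda_star a : Lambda (star a) = 3 ^ n.-1.
Proof.
have n_gt0 : 0 < n by apply: leq_ltn_trans (ltn_ord a).
rewrite Lambda_layers big_ord_recl [layer _ 0](_ : _ = 0) ?mul0n ?add0n.
  rewrite -[3]/(2 + 1) expnDn prednK //; apply: eq_bigr => k _.
  by rewrite layer_star exp1n muln1 lift0; congr (_ * 2 ^ _); lia.
apply: eq_card0 => S; rewrite inE in_star cards_eq0.
by apply/andP => -[aS /eqP S0]; rewrite S0 inE in aS.
Qed.

Lemma in_U a B S : (S \in U a B) = if a \in S then S :&: B != set0 else B \subset S.
Proof. by rewrite !inE; case: (a \in S); rewrite /= ?orbF. Qed.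

(** Complementation exchanges failure of one clause of [U a B] with the other clause. *)
Lemma U_mls a B : a \notin B -> B != set0 -> mls (U a B).
Proof.
move=> aB /set0Pn[b bB]; apply: mls_intro => [|S].
  apply/intersectingP => S S'; rewrite !in_U.
  case: ifP => aS; case: ifP => aS'.
  - by move=> _ _; apply/set0Pn; exists a; rewrite inE aS.
  - case/set0Pn => x /setIP[xS xB] /subsetP sBS'.
    by apply/set0Pn; exists x; rewrite inE xS sBS'.
  - move=> /subsetP sBS /set0Pn[x /setIP[xS' xB]].
    by apply/set0Pn; exists x; rewrite inE xS' sBS.
  - by move=> /subsetP sBS /subsetP sBS'; apply/set0Pn; exists b; rewrite inE sBS ?sBS'.
rewrite !in_U inE; case: (a \in S) => /=.
  by rewrite negbK setIC setI_eq0 disjoints_subset.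
by rewrite setIC setI_eq0 disjoints_subset setCK.
Qed.

Lemma U_singleton a B x : a \notin B -> 1 < #|B| -> [set x] \notin U a B.
Proof.
move=> aB B_gt1; rewrite in_U inE; case: eqP => [<-|_].
  by rewrite negbK setI_eq0 disjoints1.
by apply: contraL B_gt1 => /subset_leq_card; rewrite cards1 -leqNgt.
Qed.

(** For [B = [set~ a]] the first clause loses only [[set a]] and the second admits only [B];
    one-flip stars thus join the family [U]. *)
Lemma one_flip_starE a : one_flip_star a = U a [set~ a].
Proof.
apply/setP=> S; rewrite in_U in_setU in_setD1 in_star in_set1.
have [aS | aS] := boolP (a \in S).
  have -> : S == [set~ a] = false by apply/eqP => e; rewrite e !inE eqxx in aS.
  rewrite orbF andbT; congr (~~ _).
  by rewrite setI_eq0 disjoints_subset setCK subset1 orb_idr // => /eqP S0; rewrite S0 inE in aS.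
rewrite andbF /= eqEsubset andb_idl // => _.
by rewrite subsetC sub1set inE.
Qed.

(** The neighbours of [a] in the graph of two-element members. Excluding [a] itself keeps the
    degenerate pair [[set a; a]] out. *)
Definition link F a : {set 'I_n} := [set x in [set~ a] | [set a; x] \in F].

Lemma notin_link F a : a \notin link F a.
Proof. by rewrite !inE eqxx. Qed.

Lemma pair_with a S : #|S| = 2 -> a \in S -> exists2 x, x != a & S = [set a; x].
Proof.
move=> /eqP/cards2P[x [y [neqxy ->]]]; rewrite !inE => /orP[]/eqP->.
  by exists y; rewrite // eq_sym.
by exists x; rewrite // setUC.
Qed.

Lemma card_link F a : {in F, forall S : {set 'I_n}, #|S| = 2 -> a \in S} ->
  layer F 2 = #|link F a|.
Proof.
move=> aF; rewrite /layer -(card_in_imset (f := fun x => [set a; x])); last first.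
  move=> x y; rewrite !inE => /andP[neqxa _] _ /setP/(_ x).
  by rewrite !inE eqxx orbT (negPf neqxa) => /esym/eqP.
rewrite /layer; apply: eq_card => S; rewrite inE; apply/andP/imsetP => [[SF /eqP cardS]|[x]].
  have [x neqxa defS] := pair_with cardS (aF S SF cardS).
  by exists x; rewrite // !inE neqxa -defS.
by rewrite !inE => /andP[neqxa axF] ->; rewrite axF cards2 [a == x]eq_sym neqxa.
Qed.

Lemma link_U a B : a \notin B -> link (U a B) a = B.
Proof.
move=> aB; apply/setP=> x; rewrite inE in_U !inE eqxx /=.
apply/andP/idP => [[neqxa /set0Pn[y]]|xB].
  by rewrite !inE => /andP[/orP[]/eqP-> //]; rewrite (negPf aB).
split; first by apply: contraNneq aB => <-.
by apply/set0Pn; exists x; rewrite !inE eqxx orbT.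
Qed.

Section LargeBase.

Variables (a : 'I_n) (B : {set 'I_n}).
Hypotheses (n_ge5 : 5 <= n) (aB : a \notin B) (leB : n - 2 <= #|B|).

(** A member avoiding [a] contains [B], which has at least [n - 2] points, more than half of the
    ground set. *)
Lemma U_small_mem S : #|S|.*2 < n -> S \in U a B -> a \in S.
Proof.
by move=> ltSn; rewrite in_U; case: ifP => // _ /subset_leq_card; lia.
Qed.

Lemma layer_U2 : layer (U a B) 2 = #|B|.
Proof.
rewrite (@card_link _ a) ?link_U // => S SU cardS.
by apply: U_small_mem SU; rewrite cardS.
Qed.

(** At most two points lie outside [B], so a set of three or more points meets it: in these layers
    [U a B] agrees with the star. *)
Lemma layer_U k : 2 < k -> k.*2 < n -> layer (U a B) k = 'C(n.-1, k.-1).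
Proof.
move=> k_gt2 ltkn; have k_gt0 : 0 < k by lia.
rewrite -(layer_star a) prednK // /layer; apply: eq_card => S; rewrite [LHS]inE [RHS]inE.
have [/eqP cardS|] := boolP (#|S| == k); rewrite ?andbF // !andbT in_star.
apply/idP/idP => [|aS]; first by apply: U_small_mem; rewrite cardS.
rewrite in_U aS; apply: contraTneq k_gt2 => /eqP.
rewrite setI_eq0 disjoints_subset => /subset_leq_card; have := cardsC B.
by rewrite card_ord cardS; lia.
Qed.

Lemma U_kernel_free : kernel_free (U a B).
Proof.
have B_gt1 : 1 < #|B| by lia.
have n_gt0 : 0 < n by apply: leq_trans n_ge5.
have mlsU : mls (U a B) by apply: U_mls; rewrite -?card_gt0 // ltnW.
by apply/(mls_kernel_freeP n_gt0 mlsU) => x; apply: U_singleton.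
Qed.

End LargeBase.

Section Balls.

Variable (T : {set 'I_n}).
Hypothesis card_T : #|T| = 3.

(** Majority voting on three points: two majorities overlap, and of a set and its complement one has
    the majority. *)
Lemma ball_mls : mls (ball T).
Proof.
apply: mls_intro => [|S]; last first.
  by rewrite !inE ![_ :&: T]setIC -setDE; have := cardsID S T; rewrite card_T; lia.
apply/intersectingP => A B; rewrite !inE => A2 B2; apply: contraTneq isT => AB0.
have := cardsU (A :&: T) (B :&: T).
rewrite setIACA AB0 set0I cards0 -setIUl.
have := subset_leq_card (subsetIr (A :|: B) T); lia.
Qed.

Lemma ball_kernel_free : kernel_free (ball T).
Proof.
have n_gt0 : 0 < n by rewrite -[n]card_ord (leq_trans _ (max_card T)) ?card_T.
apply/(mls_kernel_freeP n_gt0 ball_mls) => x.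
by rewrite inE -leqNgt -[1](cards1 x) subset_leq_card ?subsetIl.
Qed.

Lemma layer_ball2 : layer (ball T) 2 = 3.
Proof.
rewrite -[3]/('C(3, 2)) -card_T -cards_draws /layer; apply: eq_card => S; rewrite !inE.
have [/eqP cardS|] := boolP (#|S| == 2); rewrite ?andbF // !andbT -cardS.
by rewrite (sameP setIidPl eqP) eqEcard subsetIl.
Qed.

End Balls.

(** Without a common point there are a pair [[set x; y]], one avoiding [x] and one avoiding [y];
    meeting pairwise, they form a triangle. Any further pair meets all three sides, so it contains
    two of the vertices. *)
Lemma pairs_star_or_triangle F : 0 < n -> intersecting F ->
  (exists a, {in F, forall S : {set 'I_n}, #|S| = 2 -> a \in S}) \/
  (exists2 T : {set 'I_n}, #|T| = 3 & {in F, forall S : {set 'I_n}, #|S| = 2 -> S \subset T}).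
Proof.
move=> n_gt0 /intersectingP meetF.
pose covers a := [forall S in F, (#|S| == 2) ==> (a \in S)].
have coversP a : reflect {in F, forall S : {set 'I_n}, #|S| = 2 -> a \in S} (covers a).
  apply: (iffP forall_inP) => aF S SF; first by move/eqP; apply/implyP/aF.
  by apply/implyP=> /eqP; apply: aF.
have avoid a : ~~ covers a -> exists S, [/\ S \in F, #|S| = 2 & a \notin S].
  by case/forall_inPn => S SF; rewrite negb_imply => /andP[/eqP ? ?]; exists S.
have [/existsP[a /coversP]|nocov] := boolP [exists a, covers a]; first by left; exists a.
have {}avoid a : exists S, [/\ S \in F, #|S| = 2 & a \notin S].
  by apply: avoid; move: nocov; rewrite negb_exists => /forallP/(_ a).
right.
(* The point is arbitrary; it only provides a first pair. *)
have [E [EF cardE _]] := avoid (Ordinal n_gt0).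
have /eqP/cards2P[x [y [neqxy defE]]] := cardE.
have [G [GF cardG xG]] := avoid x.
have [H [HF cardH yH]] := avoid y.
have yG : y \in G.
  have /set0Pn[u] := meetF E G EF GF; rewrite defE !inE => /andP[/orP[]/eqP-> //].
  by rewrite (negPf xG).
have xH : x \in H.
  have /set0Pn[u] := meetF E H EF HF; rewrite defE !inE => /andP[/orP[]/eqP-> //].
  by rewrite (negPf yH).
have [z neqzy defG] := pair_with cardG yG.
have [w neqwx defH] := pair_with cardH xH.
have neqxz : x != z by apply: contraNneq xG => ->; rewrite defG !inE eqxx orbT.
have eqzw : z = w.
  have /set0Pn[u] := meetF G H GF HF.
  rewrite defG defH !inE => /andP[/orP[]/eqP-> /orP[]/eqP // e].
  - by rewrite e eqxx in neqxy.
  - by rewrite e defH !inE eqxx orbT in yH.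
  - by rewrite e eqxx in neqxz.
subst w; pose T := [set x; y; z].
have cardT : #|T| = 3.
  by rewrite /T setUC cardsU1 cards2 !inE neqxy negb_or eq_sym neqxz neqzy.
exists T => // S SF cardS.
have [] : [/\ S :&: [set x; y] != set0, S :&: [set y; z] != set0
   & S :&: [set x; z] != set0].
  by split; [rewrite -defE | rewrite -defG | rewrite -defH]; apply: meetF.
have meet2 u v : S :&: [set u; v] != set0 -> (u \in S) || (v \in S).
  by case/set0Pn=> t; rewrite !inE => /andP[tS /orP[]/eqP <-]; rewrite tS ?orbT.
move=> /meet2 xy /meet2 yz /meet2 xz.
have two u v : u != v -> u \in S -> v \in S -> u \in T -> v \in T -> S \subset T.
  move=> neq uS vS uT vT; have /eqP <- : [set u; v] == S.
    by rewrite eqEcard cardS cards2 neq subUset !sub1set uS vS.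
  by rewrite subUset !sub1set uT vT.
have [xT yT zT] : [/\ x \in T, y \in T & z \in T] by rewrite !inE !eqxx !orbT.
have [xS | xS] := boolP (x \in S); have [yS | yS] := boolP (y \in S).
- exact: (two x y).
- by rewrite (negPf yS) in yz; apply: (two x z).
- by rewrite (negPf xS) in xz; apply: (two y z); rewrite // eq_sym.
- by rewrite (negPf xS) (negPf yS) in xy.
Qed.

End ConcreteSystems.

(** * Classification by the number of pairs *)

Section Classification.

Variables (n : nat) (n_ge5 : 5 <= n).
Implicit Types (M N F : {set {set 'I_n}}) (S A B T : {set 'I_n}) (a x : 'I_n).

Let n_gt0 : 0 < n. Proof. exact: leq_trans n_ge5. Qed.

Lemma mls_layer0 M : mls M -> layer M 0 = 0.
Proof.
move=> mlsM; apply: eq_card0 => S; rewrite inE cards_eq0.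
apply/andP => -[SM /eqP S0]; have := mls_meet mlsM SM SM.
by rewrite setIid S0 eqxx.
Qed.

Lemma kernel_free_layer1 M : mls M -> kernel_free M -> layer M 1 = 0.
Proof.
move=> mlsM /(mls_kernel_freeP n_gt0 mlsM) no1; apply: eq_card0 => S; rewrite inE.
by apply/andP => -[SM /cards1P[x defS]]; rewrite defS (negPf (no1 x)) in SM.
Qed.

Lemma mls_layer_le M k : mls M -> 0 < k -> k.*2 <= n -> layer M k <= 'C(n.-1, k.-1).
Proof.
move=> mlsM k_gt0 le2kn; apply: erdos_ko_rado => // [|S]; last by rewrite inE => /andP[_ /eqP].
apply/intersectingP => A B; rewrite !inE => /andP[AM _] /andP[BM _].
exact: mls_meet AM BM.
Qed.

Lemma sum_low_layers (f : nat -> nat) :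
  \sum_(k < n.+1) f k = f 0 + (f 1 + (f 2 + \sum_(3 <= k < n.+1) f k)).
Proof.
by rewrite -(big_mkord xpredT) 3?big_ltn //; lia.
Qed.

(** Exchange with a star, whose layers 1 and 2 have sizes 1 and [n.-1], while layer 1 of [M] is
    empty. *)
Lemma kernel_free_Lambda M : mls M -> kernel_free M ->
  Lambda M + (layer_gain n 1 + (n.-1 * layer_gain n 2
                + \sum_(3 <= k < n.+1) 'C(n.-1, k.-1) * layer_gain n k))
  = 3 ^ n.-1 + (layer M 2 * layer_gain n 2
                + \sum_(3 <= k < n.+1) layer M k * layer_gain n k).
Proof.
move=> mlsM kfM; pose a := Ordinal n_gt0.
have := mls_Lambda_exchange n_gt0 mlsM (star_mls a).
rewrite Lambda_star // (sum_low_layers (fun k => layer (star a) k * layer_gain n k)).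
rewrite (sum_low_layers (fun k => layer M k * layer_gain n k)) !mls_layer0 ?star_mls //.
rewrite (kernel_free_layer1 mlsM kfM) !layer_star bin0 bin1 !mul0n mul1n !add0n => <-.
do 3!congr (_ + _); rewrite !big_seq; apply: eq_bigr => k.
by rewrite mem_index_iota; case: k => // k _; rewrite layer_star.
Qed.

Lemma layer_gain0 k : n <= k.*2 -> layer_gain n k = 0.
Proof. by move=> le; apply/eqP; rewrite subn_eq0 leq_pexp2l; lia. Qed.

(** Erdos-Ko-Rado bounds the layers from 3 up to below [n / 2]; beyond them the gain vanishes. *)
Lemma kernel_free_Lambda_le M : mls M -> kernel_free M ->
  Lambda M + (layer_gain n 1 + n.-1 * layer_gain n 2)
    <= 3 ^ n.-1 + layer M 2 * layer_gain n 2.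
Proof.
move=> mlsM kfM; have := kernel_free_Lambda mlsM kfM.
suff : \sum_(3 <= k < n.+1) layer M k * layer_gain n k
    <= \sum_(3 <= k < n.+1) 'C(n.-1, k.-1) * layer_gain n k by lia.
rewrite !big_seq; apply: leq_sum => k; rewrite mem_index_iota => /andP[k_gt2 _].
have [/layer_gain0 -> | ltkn] := leqP n k.*2; first by rewrite !muln0.
by rewrite leq_mul2r mls_layer_le ?orbT //; [apply: leq_trans k_gt2 | apply: ltnW].
Qed.

Lemma kernel_free_Lambda_eq M : mls M -> kernel_free M ->
    (forall k, 2 < k -> k.*2 < n -> layer M k = 'C(n.-1, k.-1)) ->
  Lambda M + (layer_gain n 1 + n.-1 * layer_gain n 2)
    = 3 ^ n.-1 + layer M 2 * layer_gain n 2.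
Proof.
move=> mlsM kfM eqM; have := kernel_free_Lambda mlsM kfM.
suff -> : \sum_(3 <= k < n.+1) layer M k * layer_gain n k
    = \sum_(3 <= k < n.+1) 'C(n.-1, k.-1) * layer_gain n k by lia.
rewrite !big_seq; apply: eq_bigr => k; rewrite mem_index_iota => /andP[k_gt2 _].
by have [/layer_gain0 -> | ltkn] := leqP n k.*2; rewrite ?muln0 ?eqM.
Qed.

(** Facts on powers, which [lia] treats as atoms; they make the truncated subtractions exact. *)
Lemma Lambda_arith : [/\ layer_gain n 1 = 2 ^ n.-1 - 2, layer_gain n 2 = 2 ^ n.-2 - 4,
  8 <= 2 ^ n.-2, 2 ^ n.-1 = 2 * 2 ^ n.-2 & 3 * 2 ^ n.-2 <= 3 ^ n.-1].
Proof.
rewrite /layer_gain (subn1 n) (subn2 n); split=> //.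
- by have : 2 ^ 3 <= 2 ^ n.-2 by (rewrite leq_pexp2l //; lia).
- by rewrite -expnS; congr (_ ^ _); lia.
- have -> : n.-1 = n.-2.+1 by lia.
  by rewrite expnS leq_mul2l leq_exp2r //; lia.
Qed.

(** By maximality it suffices to show [U a (link M a) \subset M]. If [S] avoids [a], contains the
    link and is no member, then [~: S] is a member with at most two points, hence a pair
    [[set a; x]] with [x] in the link, contradicting [x \notin S]. *)
Lemma mls_eq_U_link M a : mls M -> kernel_free M -> n - 2 <= #|link M a| ->
  M = U a (link M a).
Proof.
move=> mlsM /(mls_kernel_freeP n_gt0 mlsM) no1 le_link.
have mlsU : mls (U a (link M a)).
  by apply: U_mls; rewrite ?notin_link // -card_gt0; lia.
apply: (mls_subset_eq mlsU mlsM); apply/subsetP => S; rewrite in_U.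
case: ifP => aS.
  case/set0Pn => x; rewrite !inE => /and3P[xS _ axM].
  by apply: (mls_up mlsM axM); rewrite subUset !sub1set aS.
move=> sLS; apply: contraT; rewrite -mls_compl // => CM.
have aC : a \in ~: S by rewrite inE aS.
have card_C : #|~: S| <= 2.
  have := subset_leq_card sLS; have := cardsC S; rewrite card_ord; lia.
have C_neq1 : #|~: S| != 1.
  by apply/negP => /cards1P[x defC]; rewrite defC (negPf (no1 x)) in CM.
have C_gt0 : 0 < #|~: S| by apply/card_gt0P; exists a.
have [x neqxa defC] : exists2 x, x != a & ~: S = [set a; x] by apply: pair_with => //; lia.
have xS : x \in S by apply: (subsetP sLS); rewrite !inE neqxa -defC.
have : x \in ~: S by rewrite defC !inE eqxx orbT.
by rewrite inE xS.
Qed.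

Lemma link_le F a : #|link F a| <= n.-1.
Proof.
rewrite -[n in n.-1]card_ord -(cardsC1 a) subset_leq_card //.
by apply/subsetP=> x; rewrite !inE => /andP[].
Qed.

(** In the triangle case at most 3 pairs exist, so [n - 2 <= 3] forces [n = 5] and all three sides
    are members; upward closure then yields the ball. *)
Lemma mls_many_pairs M : mls M -> kernel_free M -> n - 2 <= layer M 2 ->
  (exists a B, [/\ a \notin B, layer M 2 = #|B|, #|B| <= n.-1 & M = U a B])
  \/ [/\ n = 5, layer M 2 = 3 & exists2 T : {set 'I_n}, #|T| = 3 & M = ball T].
Proof.
move=> mlsM kfM le_pairs; have intM : intersecting M.
  by apply/intersectingP => A B; apply: mls_meet.
have [[a aM]|[T cardT pairsT]] := pairs_star_or_triangle n_gt0 intM.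
  left; exists a, (link M a); have cardL := card_link aM.
  split; rewrite ?notin_link ?link_le //.
  by apply: mls_eq_U_link; rewrite // -cardL.
have sMT : [set S in M | #|S| == 2] \subset [set S : {set 'I_n} | S \subset T & #|S| == 2].
  by apply/subsetP=> S; rewrite !inE => /andP[SM /eqP cardS]; rewrite pairsT // cardS.
have := subset_leq_card sMT; rewrite cards_draws cardT -/(layer M 2) (_ : 'C(3, 2) = 3) // => le3.
right; split; [lia | lia | exists T => //].
have /eqP eqMT : [set S in M | #|S| == 2] == [set S : {set 'I_n} | S \subset T & #|S| == 2].
  by rewrite eqEcard sMT cards_draws cardT -/(layer M 2) (_ : 'C(3, 2) = 3) //; lia.
apply: (mls_subset_eq (ball_mls cardT) mlsM); apply/subsetP=> S; rewrite inE => S2.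
have [x [y [xS yS neqxy]]] := card_gt1P S2.
move: xS yS; rewrite !inE => /andP[xS xT] /andP[yS yT].
have : [set x; y] \in [set S in M | #|S| == 2].
  by rewrite eqMT inE subUset !sub1set xT yT cards2 neqxy.
rewrite inE => /andP[xyM _]; apply: (mls_up mlsM xyM).
by rewrite subUset !sub1set xS.
Qed.

Lemma U_Lambda a B : a \notin B -> n - 2 <= #|B| ->
  Lambda (U a B) + (layer_gain n 1 + n.-1 * layer_gain n 2)
    = 3 ^ n.-1 + #|B| * layer_gain n 2.
Proof.
move=> aB leB; have B_gt0 : 0 < #|B| by lia.
rewrite kernel_free_Lambda_eq ?layer_U2 //; last exact: layer_U.
- by apply: U_mls; rewrite -?card_gt0.
- exact: U_kernel_free.
Qed.

(** If [a] and [a'] differ, each pair [[set a; x]] with [x \in B] is small and so contains [a'],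
    whence [x = a'] and [B] is too small. *)
Lemma U_eq a B a' B' : a \notin B -> a' \notin B' -> n - 2 <= #|B| -> n - 2 <= #|B'| ->
  U a B = U a' B' -> a = a' /\ B = B'.
Proof.
move=> aB aB' leB leB' eqU; have eqa : a = a'.
  apply/eqP; apply: contraT => neqa.
  have sB : B \subset [set a'].
    apply/subsetP=> x xB; rewrite inE.
    have : x \in link (U a B) a by rewrite link_U.
    rewrite in_set eqU => /andP[_ /(U_small_mem n_ge5 aB' leB') a'x].
    have : a' \in [set a; x] by apply: a'x; rewrite cards2; case: (_ != _); lia.
    by rewrite !inE eq_sym (negPf neqa) eq_sym.
  by have := subset_leq_card sB; rewrite cards1; lia.
by split=> //; rewrite -(link_U aB) eqU eqa link_U.
Qed.

End Classification.

(** * The bound, its equality cases and their number *)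

Section ExtremalValues.

Variables (n : nat) (n_ge5 : 5 <= n).
Implicit Types (M N F : {set {set 'I_n}}) (S A B T : {set 'I_n}) (a x : 'I_n).

Lemma one_flip_star_mls a : mls (one_flip_star a) /\ kernel_free (one_flip_star a).
Proof.
have card_Ca : #|[set~ a]| = n.-1 by rewrite cardsC1 card_ord.
rewrite one_flip_starE; split.
  by apply: U_mls; rewrite ?inE ?eqxx // -card_gt0 card_Ca; lia.
by apply: U_kernel_free; rewrite ?inE ?eqxx // card_Ca; lia.
Qed.

Lemma Lambda_one_flip_star a : Lambda (one_flip_star a) = Mstar n.
Proof.
have card_Ca : #|[set~ a]| = n.-1 by rewrite cardsC1 card_ord.
have := @U_Lambda n n_ge5 a [set~ a]; rewrite -one_flip_starE card_Ca !inE eqxx.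
move=> /(_ isT); rewrite /Mstar; have [-> -> ? ? ?] := Lambda_arith n_ge5; lia.
Qed.

(** With [n.-1] pairs, [B] would be all of [[set~ a]], giving a one-flip star; a ball has only
    [3 = n.-2] pairs. *)
Lemma nonextremal_pairs M : nonextremal_mls M -> layer M 2 <= n.-2.
Proof.
case=> mlsM kfM notflip; rewrite leqNgt; apply/negP => gt_pairs.
have [|[a [B [aB cardB leB defM]]]|[n5 card2 _]] := mls_many_pairs n_ge5 mlsM kfM.
- by lia.
- apply: (notflip a); rewrite defM one_flip_starE; congr (U a _); apply/eqP.
  rewrite eqEcard cardsC1 card_ord subsetC sub1set inE aB -cardB.
  lia.
- by lia.
Qed.

Lemma nonextremal_Lambda M : nonextremal_mls M ->
  Lambda M <= 3 ^ n.-1 - 3 * 2 ^ n.-2 + 6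
  /\ (Lambda M = 3 ^ n.-1 - 3 * 2 ^ n.-2 + 6 -> layer M 2 = n.-2).
Proof.
move=> nonM; have le_pairs := nonextremal_pairs nonM; case: nonM => mlsM kfM _.
have := kernel_free_Lambda_le n_ge5 mlsM kfM.
have [-> -> ? ? ?] := Lambda_arith n_ge5.
have -> g : n.-1 * g = g + (n.-2 - layer M 2) * g + layer M 2 * g.
  by rewrite -mulSn -mulnDl; congr (_ * g); lia.
have : 2 ^ n.-2 = (2 ^ n.-2 - 4) + 4 by lia.
move: (2 ^ n.-2 - 4) => g def_q.
(* Every pair short of [n.-2] costs a further [g > 0], so equality is possible only for [d = 0]. *)
case def_d: (n.-2 - layer M 2) => [|d]; rewrite ?mulSn;
  move: (layer M 2 * g) => Lg; [lia | move: (d * g) => dg; lia].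
Qed.

Lemma pairs_Lambda M : mls M -> kernel_free M -> layer M 2 = n.-2 ->
    (forall k, 2 < k -> k.*2 < n -> layer M k = 'C(n.-1, k.-1)) ->
  nonextremal_mls M /\ Lambda M = 3 ^ n.-1 - 3 * 2 ^ n.-2 + 6.
Proof.
move=> mlsM kfM pairsM /(kernel_free_Lambda_eq n_ge5 mlsM kfM).
rewrite pairsM; have [-> -> ? ? ?] := Lambda_arith n_ge5.
have -> g : n.-1 * g = g + n.-2 * g by rewrite -mulSn; congr (_ * g); lia.
move=> eqL; have {}eqL : Lambda M = 3 ^ n.-1 - 3 * 2 ^ n.-2 + 6 by lia.
(* One-flip stars are excluded by their strictly larger weight. *)
split=> //; split=> // a eqM; have := Lambda_one_flip_star a.
by rewrite -eqM eqL /Mstar; lia.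
Qed.

Lemma U_systemsP M :
  reflect (exists a B, [/\ a \notin B, #|B| = n.-2 & M = U a B]) (M \in U_systems n).
Proof.
apply: (iffP imset2P) => [[a B _]|[a [B [aB cardB ->]]]].
  rewrite inE subsetC sub1set inE => /andP[aB /eqP cardB] ->.
  by exists a, B.
by exists a B; rewrite ?inE // subsetC sub1set inE aB cardB /=.
Qed.

Lemma ball_systemsP M :
  reflect (exists2 T : {set 'I_n}, #|T| = 3 & M = ball T) (M \in ball_systems n).
Proof.
by apply: (iffP imsetP) => -[T]; rewrite ?inE => cardT ->; exists T; rewrite ?inE; apply/eqP.
Qed.

Lemma U_systems_extremal M : M \in U_systems n ->
  nonextremal_mls M /\ Lambda M = 3 ^ n.-1 - 3 * 2 ^ n.-2 + 6.
Proof.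
case/U_systemsP=> a [B [aB cardB ->]]; have leB : n - 2 <= #|B| by lia.
apply: pairs_Lambda.
- by apply: U_mls; rewrite // -card_gt0; lia.
- exact: U_kernel_free.
- by rewrite layer_U2.
- exact: layer_U.
Qed.

Lemma ball_systems_extremal M : n = 5 -> M \in ball_systems n ->
  nonextremal_mls M /\ Lambda M = 3 ^ n.-1 - 3 * 2 ^ n.-2 + 6.
Proof.
move=> n5 /ball_systemsP[T cardT ->]; apply: pairs_Lambda.
- exact: ball_mls.
- exact: ball_kernel_free.
- by rewrite layer_ball2 // n5.
(* For [n = 5] no [k] satisfies [2 < k] and [k.*2 < n]. *)
- by move=> k; lia.
Qed.

Lemma extremal_systems M : nonextremal_mls M ->
    Lambda M = 3 ^ n.-1 - 3 * 2 ^ n.-2 + 6 ->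
  M \in U_systems n \/ n = 5 /\ M \in ball_systems n.
Proof.
move=> nonM /(nonextremal_Lambda nonM).2 pairsM; have [mlsM kfM _] := nonM.
have [|[a [B [aB cardB _ defM]]]|[n5 _ ballM]] := mls_many_pairs n_ge5 mlsM kfM.
- by lia.
- by left; apply/U_systemsP; exists a, B; rewrite -cardB.
- by right; split=> //; apply/ball_systemsP.
Qed.

(** By [U_eq] the parametrisation by pairs [(a, B)] is injective, and each [a] leaves
    ['C(n.-1, n.-2)] choices of [B]. *)
Lemma card_U_systems : #|U_systems n| = n * n.-1.
Proof.
pose D := [set p : 'I_n * {set 'I_n} | (p.2 \subset [set~ p.1]) && (#|p.2| == n.-2)].
have memD a B : ((a, B) \in D) = (a \notin B) && (#|B| == n.-2).
  by rewrite inE /= subsetC sub1set inE.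
have -> : U_systems n = (fun p => U p.1 p.2) @: D.
  apply/setP=> M; apply/U_systemsP/imsetP => [[a [B [aB cardB ->]]]|[[a B]]].
    by exists (a, B); rewrite // memD aB cardB /=.
  by rewrite memD => /andP[aB /eqP cardB] ->; exists a, B.
rewrite card_in_imset; last first.
  move=> [a B] [a' B']; rewrite !memD /= => /andP[aB /eqP cardB] /andP[aB' /eqP cardB'].
  have [leB leB'] : n - 2 <= #|B| /\ n - 2 <= #|B'| by rewrite cardB cardB' subn2.
  by case/(U_eq n_ge5 aB aB' leB leB') => -> ->.
transitivity (\sum_(a : 'I_n) \sum_(B : {set 'I_n} | (B \subset [set~ a]) && (#|B| == n.-2)) 1).
  by rewrite pair_big_dep -sum1_card; apply: eq_bigl => p; rewrite inE.
rewrite (eq_bigr (fun=> n.-1)) ?sum_nat_const ?card_ord // => a _.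
rewrite sum1dep_card cards_draws cardsC1 card_ord.
have -> : n.-1 = n.-2.+1 by lia.
exact: binSn.
Qed.

Lemma pair_in_ball T x y : x != y -> ([set x; y] \in ball T) = (x \in T) && (y \in T).
Proof.
move=> neqxy; rewrite inE; have <- : #|[set x; y]| = 2 by rewrite cards2 neqxy.
apply/idP/andP => [le2 | [xT yT]].
  have /eqP/setIidPl : [set x; y] :&: T == [set x; y] by rewrite eqEcard subsetIl.
  by rewrite subUset !sub1set => /andP.
by apply/subset_leq_card; rewrite subsetI subxx subUset !sub1set xT.
Qed.

(** The two-element members of a ball cover exactly its centre [T]. *)
Lemma ball_subset T T' : #|T| = 3 -> ball T = ball T' -> T \subset T'.
Proof.
move=> cardT eqball; apply/subsetP=> x xT.
have /card_gt0P[y] : 0 < #|T :\ x| by have := cardsD1 x T; rewrite cardT xT; lia.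
rewrite !inE => /andP[neqyx yT].
have : [set x; y] \in ball T by rewrite pair_in_ball 1?eq_sym // xT.
by rewrite eqball pair_in_ball 1?eq_sym // => /andP[].
Qed.

Lemma card_ball_systems : #|ball_systems n| = 'C(n, 3).
Proof.
rewrite card_in_imset ?card_draws ?card_ord // => T T'; rewrite !inE => /eqP cardT /eqP cardT'.
by move=> eqball; apply/eqP; rewrite eqEsubset !ball_subset.
Qed.

(** Two points of [T] other than [a] form a pair in the ball, whereas every pair in [U a B] contains
    [a]. *)
Lemma disjoint_U_ball_systems : [disjoint U_systems n & ball_systems n].
Proof.
apply/pred0Pn => -[M /andP[/U_systemsP[a [B [aB cardB ->]]] /ball_systemsP[T cardT eqM]]].
have /card_gt1P[x [y [xT yT neqxy]]] : 1 < #|T :\ a|.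
  by rewrite -(ltn_add2l (a \in T)) -cardsD1 cardT; case: (a \in T).
move: xT yT; rewrite !inE => /andP[neqxa xT] /andP[neqya yT].
have : [set x; y] \in U a B by rewrite eqM pair_in_ball // xT.
have leB : n - 2 <= #|B| by lia.
have card2 : #|[set x; y]|.*2 < n by rewrite cards2 neqxy; lia.
move/(U_small_mem n_ge5 aB leB card2).
by rewrite !inE ![a == _]eq_sym (negPf neqxa) (negPf neqya).
Qed.

End ExtremalValues.

Theorem theorem5p5 (n : nat) (hn : 5 <= n) :
  (* the upper bound, in both forms, and its attainment *)
  (forall M : {set {set 'I_n}}, nonextremal_mls M ->
     Lambda M <= Mstar n - (2 ^ n.-2 - 4))
  /\ Mstar n - (2 ^ n.-2 - 4) = 3 ^ n.-1 - 3 * 2 ^ n.-2 + 6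
  /\ (exists M : {set {set 'I_n}},
        nonextremal_mls M /\ Lambda M = 3 ^ n.-1 - 3 * 2 ^ n.-2 + 6)
  (* the cases of equality, with their number *)
  /\ (forall M : {set {set 'I_n}},
        nonextremal_mls M /\ Lambda M = 3 ^ n.-1 - 3 * 2 ^ n.-2 + 6
        <-> M \in U_systems n \/ n = 5 /\ M \in ball_systems n)
  /\ #|U_systems n| = n * n.-1
  /\ (n = 5 -> #|ball_systems n| = 10
               /\ [disjoint U_systems n & ball_systems n])
  (* Mstar n is the maximum over all kernel-free systems, and the gap below *)
  /\ (forall M : {set {set 'I_n}}, mls M -> kernel_free M -> Lambda M <= Mstar n)
  /\ (exists M : {set {set 'I_n}},
        [/\ mls M, kernel_free M & Lambda M = Mstar n])
  /\ ~ (exists M : {set {set 'I_n}},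
          [/\ mls M, kernel_free M
            & 3 ^ n.-1 - 3 * 2 ^ n.-2 + 6 < Lambda M < Mstar n])
  /\ Mstar n = (3 ^ n.-1 - 3 * 2 ^ n.-2 + 6) + (2 ^ n.-2 - 4).
Proof.
have [_ _ q_ge8 q2 q3] := Lambda_arith hn.
have eqM : Mstar n - (2 ^ n.-2 - 4) = 3 ^ n.-1 - 3 * 2 ^ n.-2 + 6.
  by rewrite /Mstar; lia.
have eqM' : Mstar n = 3 ^ n.-1 - 3 * 2 ^ n.-2 + 6 + (2 ^ n.-2 - 4).
  by rewrite /Mstar; lia.
have n_gt0 : 0 < n by lia.
pose a := Ordinal n_gt0.
(* This dichotomy yields both the maximum and the gap: a one-flip star has weight [Mstar n], and any
   other kernel-free system obeys the lower bound. *)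
have flipP (M : {set {set 'I_n}}) : mls M -> kernel_free M ->
    (exists a, M = one_flip_star a) \/ nonextremal_mls M.
  move=> mlsM kfM; case: (pickP (fun a => M == one_flip_star a)) => [b /eqP|noflip].
    by left; exists b.
  by right; split=> // b eqMb; have := noflip b; rewrite eqMb eqxx.
have bound (M : {set {set 'I_n}}) : nonextremal_mls M ->
    Lambda M <= 3 ^ n.-1 - 3 * 2 ^ n.-2 + 6.
  by move=> nonM; have [] := nonextremal_Lambda hn nonM.
split; first by move=> M /bound; rewrite eqM.
split=> //; split.
  have /card_gt0P[M MU] : 0 < #|U_systems n| by rewrite card_U_systems // muln_gt0; lia.
  by exists M; apply: U_systems_extremal.
split.
  move=> M; split=> [[nonM]|[|[n5]]]; first exact: extremal_systems.
    exact: U_systems_extremal.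
  exact: ball_systems_extremal.
split; first exact: card_U_systems.
split.
  by move=> n5; rewrite card_ball_systems {1}n5; split=> //; apply: disjoint_U_ball_systems.
split.
  move=> M mlsM kfM; case: (flipP M mlsM kfM) => [[b ->]|/bound]; last by lia.
  by rewrite Lambda_one_flip_star.
split.
  by exists (one_flip_star a); have [? ?] := one_flip_star_mls hn a; rewrite Lambda_one_flip_star.
split=> // -[M [mlsM kfM /andP[gtL ltL]]].
case: (flipP M mlsM kfM) => [[b eqMb]|/bound]; last by lia.
by rewrite eqMb Lambda_one_flip_star // ltnn in ltL.
Qed.
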